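(* Let $m,n$ be positive integers, let $f$ be a positive continuous decreasing function on $\mathbb{R}_+$ with inverse function $f^{-1}$ and $f(T)\to0$ as $T\to\infty$, and let $g(T)=\dfrac1{f^{-1}(1/T)}$. Suppose there is $\gamma>0$ such that $f(CT)\le C^{-\gamma}f(T)$ for all $T>0$ and all sufficiently large $C>1$. Let $\Theta$ be a real $n\times m$ matrix such that $\Theta^\top$ is $f$-approximable, and let $\Omega$ be the set of all asymptotic directions for the best approximations of $\Theta^\top$. Let $\mathcal A$ be an affine subspace of $\mathbb{R}^n$ of positive dimension, with corresponding linear subspace $\mathcal L$ and orthogonal complement $\mathcal L^\perp$. If $\Theta^\top$ is trivially singular, assume also that $\mathcal A$ is not exceptional. If $\mathcal L^\perp\cap\Omega=\emptyset$, then the set $\left(\widehat{\mathbf{Sing}}^{\Theta}_{n,m}[g]\right)^c\cap\mathcal A$ is HAW in $\mathcal A$. In particular, the set $\left(\widehat{\mathbf{Sing}}^{\Theta}_{n,m}[g]\right)^c$ is HAW.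
   Context: $|\cdot|$ is the supremum norm; $\|\mathbf v\|_{\mathbb{Z}^k}=\min_{\mathbf p\in\mathbb{Z}^k}|\mathbf v-\mathbf p|$. Complements are taken in $\mathbb{R}^n$. A real $a\times b$ matrix $\Phi$ is $F$-approximable if $\|\Phi\mathbf x\|_{\mathbb{Z}^a}^a\le F(|\mathbf x|^b)$ for infinitely many $\mathbf x\in\mathbb{Z}^b\setminus\{\mathbf 0\}$ (for $\Theta^\top$: $a=m$, $b=n$). $\widehat{\mathbf{Sing}}^{\Theta}_{n,m}[g]$ is the set of $\pmb\eta\in\mathbb{R}^n$ such that for every $\varepsilon>0$ and all sufficiently large $T$ there is a nonzero $\mathbf q\in\mathbb{Z}^m$ with $\|\Theta\mathbf q-\pmb\eta\|_{\mathbb{Z}^n}^n\le\varepsilon g(T)$ and $|\mathbf q|^m\le T$. $\Theta^\top$ is trivially singular if $\Theta^\top\mathbf z\in\mathbb{Z}^m$ for some nonzero $\mathbf z\in\mathbb{Z}^n$; in that case $\mathcal A$ is exceptional if it is contained in a hyperplane $\{\pmb\eta\in\mathbb{R}^n:\pmb\eta\cdot\mathbf z=a\}$ with $a\in\mathbb{Z}$ and $\mathbf z\in\mathbb{Z}^n\setminus\{\mathbf 0\}$, $\Theta^\top\mathbf z\in\mathbb{Z}^m$. If $\Theta^\top$ is not trivially singular, put $\psi_{\Theta^\top}(t)=\min_{\mathbf y\in\mathbb{Z}^n,\,0<|\mathbf y|\le t}\|\Theta^\top\mathbf y\|_{\mathbb{Z}^m}$; the best approximation vectors $\mathbf y_\nu\in\mathbb{Z}^n$,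 with $Y_\nu=|\mathbf y_\nu|$, $1=Y_1<Y_2<\dots$, satisfy $\psi_{\Theta^\top}(t)=\|\Theta^\top\mathbf y_\nu\|_{\mathbb{Z}^m}$ for $Y_\nu\le t<Y_{\nu+1}$, with $\psi_{\Theta^\top}(Y_\nu)$ strictly decreasing. An asymptotic direction is a limit, along a subsequence of $\nu$, of the unit vectors $\pm\mathbf y_\nu$ (normalized to lie on the unit sphere $S^{n-1}$). If $\Theta^\top$ is trivially singular, $\Omega=\emptyset$. HAW (hyperplane absolute winning): for $0<\beta<\frac13$, in the $\beta$-hyperplane absolute game on $\mathbb{R}^d$ Bob first chooses a closed ball $B_0$ of radius $r_0>0$; at stage $i\ge0$ Alice chooses an affine hyperplane $H_i$ and $0<\epsilon_i\le\beta r_i$, and Bob then chooses a closed ball $B_{i+1}\subset B_i$ disjoint from the $\epsilon_i$-neighborhood of $H_i$, of radius $r_{i+1}\ge\beta r_i$. A set $S$ is HAW if for every $0<\beta<\frac13$ Alice has a strategy guaranteeing $S\cap\bigcap_iB_i\ne\emptyset$. ''HAW in $\mathcal A$'' means the same with $\mathcal A$ identified isometrically with $\mathbb{R}^{\dim\mathcal A}$. *)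

(* Defs.v *)
From HB Require Import structures.
From mathcomp Require Import all_boot all_order all_algebra.
From mathcomp Require Import all_classical all_reals all_analysis.

Set Implicit Arguments.
Unset Strict Implicit.
Unset Printing Implicit Defensive.

Import Order.TTheory GRing.Theory Num.Theory numFieldNormedType.Exports.
Local Open Scope classical_set_scope.
Local Open Scope ring_scope.

(* The library norm [`|v|] on ['cV[R]_k] is the supremum norm. *)

Section Approximation.
Variable R : realType.

Definition intv k (p : 'cV[int]_k) : 'cV[R]_k := map_mx intr p.

Definition int_dist k (v : 'cV[R]_k) : R :=
  inf [set `|v - intv p| | p in [set: 'cV[int]_k]].

Definition approximable a b (Phi : 'M[R]_(a, b)) (F : R -> R) : Prop :=
  infinite_set [set x : 'cV[int]_b |
    x != 0 /\ int_dist (Phi *m intv x) ^+ a <= F (`|intv x| ^+ b)].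

Definition singular_hat n m (Theta : 'M[R]_(n, m)) (g : R -> R)
    : set 'cV[R]_n :=
  [set eta | forall eps : R, 0 < eps -> \forall T \near +oo,
    exists q : 'cV[int]_m,
      [/\ q != 0, int_dist (Theta *m intv q - eta) ^+ n <= eps * g T
        & `|intv q| ^+ m <= T]].

Definition integral_relation m n (Phi : 'M[R]_(m, n)) (z : 'cV[int]_n) : Prop :=
  z != 0 /\ exists p : 'cV[int]_m, Phi *m intv z = intv p.

Definition trivially_singular m n (Phi : 'M[R]_(m, n)) : Prop :=
  exists z, integral_relation Phi z.

Definition dotv k (u v : 'cV[R]_k) : R := (u^T *m v) 0 0.

Definition enorm k (v : 'cV[R]_k) : R := Num.sqrt (dotv v v).

Definition exceptional m n (Phi : 'M[R]_(m, n)) (A : set 'cV[R]_n) : Prop :=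
  exists (z : 'cV[int]_n) (a : int), integral_relation Phi z /\
    A `<=` [set eta | dotv eta (intv z) = a%:~R].

Definition psi m n (Phi : 'M[R]_(m, n)) (t : R) : R :=
  inf [set int_dist (Phi *m intv y) |
        y in [set y : 'cV[int]_n | 0 < `|intv y| <= t]].

(* Indexed from 0. Two non-proportional integer vectors may tie, so
   best approximation vectors need not be unique up to sign: this predicate
   accepts every admissible choice of the sequence. *)
Definition best_approximations m n (Phi : 'M[R]_(m, n))
    (y : nat -> 'cV[int]_n) : Prop :=
  [/\ `|intv (y 0%N)| = 1,
      forall nu, `|intv (y nu)| < `|intv (y nu.+1)|,
      forall nu (t : R), `|intv (y nu)| <= t < `|intv (y nu.+1)| ->
        psi Phi t = int_dist (Phi *m intv (y nu))
    & forall nu, psi Phi `|intv (y nu.+1)| < psi Phi `|intv (y nu)|].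

Definition unitv k (v : 'cV[R]_k) : 'cV[R]_k := (enorm v)^-1 *: v.

(* The sign [(-1) ^+ s k] may vary along the subsequence. *)
Definition asymptotic_directions m n (Phi : 'M[R]_(m, n))
    (y : nat -> 'cV[int]_n) : set 'cV[R]_n :=
  [set w | ~ trivially_singular Phi /\
    exists (phi : nat -> nat) (s : nat -> bool),
      (forall k, (phi k < phi k.+1)%N) /\
      (fun k => (-1) ^+ s k *: unitv (intv (y (phi k)))) @ \oo --> w].

Definition affine_subspace n (a0 : 'cV[R]_n) (L : {vspace 'cV[R]_n})
    : set 'cV[R]_n :=
  [set a0 + v | v in [set v | v \in L]].

Definition orthocompl n (L : {vspace 'cV[R]_n}) : set 'cV[R]_n :=
  [set w | forall v, v \in L -> dotv w v = 0].

End Approximation.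

Section HyperplaneAbsoluteGame.
Variables (R : realType) (d : nat).

(* Balls and neighborhoods in the game are Euclidean. *)
Record ball_data := BallData { center : 'cV[R]_d; radius : R }.

Definition closed_ball_set (b : ball_data) : set 'cV[R]_d :=
  [set x | enorm (x - center b) <= radius b].

(* Alice's move: the hyperplane {x | x . normal = offset} and the width. *)
Record hyperplane_move :=
  HyperplaneMove { normal : 'cV[R]_d; offset : R; width : R }.

Definition hyperplane (a : hyperplane_move) : set 'cV[R]_d :=
  [set x | dotv x (normal a) = offset a].

Definition removed (a : hyperplane_move) : set 'cV[R]_d :=
  [set x | exists2 h, hyperplane a h & enorm (x - h) < width a].

Definition alice_legal (beta : R) (b : ball_data) (a : hyperplane_move) : Prop :=
  normal a != 0 /\ 0 < width a <= beta * radius b.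

Definition bob_legal (beta : R) (b : ball_data) (a : hyperplane_move)
    (b' : ball_data) : Prop :=
  [/\ closed_ball_set b' `<=` closed_ball_set b,
      closed_ball_set b' `&` removed a = set0
    & beta * radius b <= radius b'].

(* A strategy reads the list of Bob's earlier balls and his current ball. *)
Definition strategy := seq ball_data -> ball_data -> hyperplane_move.

Definition winning_strategy (beta : R) (S : set 'cV[R]_d) (sigma : strategy)
    : Prop :=
  (forall past b, 0 < radius b -> alice_legal beta b (sigma past b)) /\
  (forall B : nat -> ball_data,
     0 < radius (B 0%N) ->
     (forall i, bob_legal beta (B i) (sigma (mkseq B i) (B i)) (B i.+1)) ->
     S `&` \bigcap_i closed_ball_set (B i) !=set0).

Definition HAW (S : set 'cV[R]_d) : Prop :=
  forall beta : R, 0 < beta < 3%:R^-1 -> exists sigma, winning_strategy beta S sigma.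

End HyperplaneAbsoluteGame.

Definition HAW_in (R : realType) n (a0 : 'cV[R]_n) (L : {vspace 'cV[R]_n})
    (S : set 'cV[R]_n) : Prop :=
  exists iota : 'cV[R]_(\dim L) -> 'cV[R]_n,
    [/\ forall x y, enorm (iota x - iota y) = enorm (x - y),
        range iota = affine_subspace a0 L
      & HAW (iota @^-1` S)].

(* Main.v *)
Require Import Defs.
From HB Require Import structures.
From mathcomp Require Import all_boot all_order all_algebra.
From mathcomp Require Import all_classical all_reals all_analysis.
From mathcomp Require Import ring lra.

Set Implicit Arguments.
Unset Strict Implicit.
Unset Printing Implicit Defensive.

Import Order.TTheory GRing.Theory Num.Theory numFieldNormedType.Exports.
Local Open Scope classical_set_scope.
Local Open Scope ring_scope.

(** Let [y] be an integer vector for which [Theta^T y] is close to an integer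
    vector. For integer [q], [p], [p'], the number [eta . y] equals
    [(Theta^T y - p') . q - y . (Theta q - eta - p)] up to an integer. So if
    [eta . y] stays at distance [kappa] from the integers, then
    [kappa <= n |y| dist (Theta q - eta) + m |q| dist (Theta^T y)]
    ([transference]). When [dist (Theta^T y) ^ m <= f (|y| ^ n)], the last term
    is at most [kappa / 2] for all [q] with [|q| ^ m <= T := c / f (|y| ^ n)],
    which leaves [dist (Theta q - eta) ^ n] at least a constant times
    [|y| ^ -n]; the growth condition on [f] says that [g T] is at most a
    constant times [|y| ^ -n] ([inverse_growth]). Hence [eta] is outside the
    singular set as soon as there are such vectors [y k] with norms tending to
    infinity and [eta . y k] is, for infinitely many [k], at distance at least
    [kappa] from the integers ([often_far], [often_far_not_singular]).

    It remains to win the game for this last condition. In orthonormal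
    coordinates [eta = a0 + E x] on the affine subspace, [eta . y k] is the
    affine form [x . w k + b k] with [w k = E^T (y k)]. Suppose that
    [enorm (w k)] tends to infinity. The hyperplanes on which such a form is an
    integer are at distance [1 / enorm (w k)] from each other, so a ball of
    radius [r] with [beta / 4 < r * enorm (w k) <= 1 / 4] comes close to one of
    them only, and Alice deletes a neighborhood of that one of width [beta r].
    As Bob's radii shrink at each stage by a factor at least [beta], no large
    [k] is skipped if they shrink to 0, and Alice deals with infinitely many of
    them; if they do not, the intersection of the balls has interior points, and
    the target set is residual, hence dense ([HAW_often_far]).

    That [enorm (w k)] tends to infinity is where asymptotic directions enter.
    If [Theta^T] is not trivially singular, infinitely many best approximations
    realize [f]-approximability ([best_approximations_approx]); along a
    subsequence their directions converge to a vector of [Omega]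
    ([asymptotic_subsequence]), which is not orthogonal to [L], so the
    projections to [L] grow like the vectors themselves ([enorm_proj_cvgy]).
    If [Theta^T z] is an integer vector, one takes the multiples of [z]; when
    [z] is orthogonal to [L], the form [eta . z] is constant on the subspace,
    and this constant is not an integer because the subspace is not
    exceptional. For the whole space no projection is involved, and any
    sequence realizing [f]-approximability will do. *)

(** * Euclidean geometry of column vectors *)

Section Euclid.
Variable R : realType.

Lemma dotvE n (u v : 'cV[R]_n) : dotv u v = \sum_i u i 0 * v i 0.
Proof. by rewrite /dotv mxE; apply: eq_bigr => i _; rewrite mxE. Qed.

Lemma dotvC n (u v : 'cV[R]_n) : dotv u v = dotv v u.
Proof. by rewrite !dotvE; apply: eq_bigr => i _; rewrite mulrC. Qed.

Lemma dotvDr n (u v w : 'cV[R]_n) : dotv u (v + w) = dotv u v + dotv u w.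
Proof. by rewrite /dotv mulmxDr mxE. Qed.

Lemma dotvZr n a (u v : 'cV[R]_n) : dotv u (a *: v) = a * dotv u v.
Proof. by rewrite /dotv -scalemxAr mxE. Qed.

Lemma dotvNr n (u v : 'cV[R]_n) : dotv u (- v) = - dotv u v.
Proof. by rewrite /dotv mulmxN mxE. Qed.

Lemma dotvBr n (u v w : 'cV[R]_n) : dotv u (v - w) = dotv u v - dotv u w.
Proof. by rewrite dotvDr dotvNr. Qed.

Lemma dotvDl n (u v w : 'cV[R]_n) : dotv (u + v) w = dotv u w + dotv v w.
Proof. by rewrite ![dotv _ w]dotvC dotvDr. Qed.

Lemma dotvZl n a (u v : 'cV[R]_n) : dotv (a *: u) v = a * dotv u v.
Proof. by rewrite ![dotv _ v]dotvC dotvZr. Qed.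

Lemma dotvBl n (u v w : 'cV[R]_n) : dotv (u - v) w = dotv u w - dotv v w.
Proof. by rewrite ![dotv _ w]dotvC dotvBr. Qed.

Lemma dotv0r n (u : 'cV[R]_n) : dotv u 0 = 0.
Proof. by rewrite /dotv mulmx0 mxE. Qed.

Lemma dotv_mulmxl n k (E : 'M[R]_(n, k)) x (v : 'cV[R]_n) :
  dotv (E *m x) v = dotv x (E^T *m v).
Proof. by rewrite /dotv trmx_mul mulmxA. Qed.

Lemma dotv_mulmxr n k (E : 'M[R]_(n, k)) x (v : 'cV[R]_n) :
  dotv v (E *m x) = dotv (E^T *m v) x.
Proof. by rewrite dotvC dotv_mulmxl dotvC. Qed.

Lemma dotvv_ge0 n (v : 'cV[R]_n) : 0 <= dotv v v.
Proof. by rewrite dotvE sumr_ge0// => i _; rewrite -expr2 sqr_ge0. Qed.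

Lemma dotvv_eq0 n (v : 'cV[R]_n) : (dotv v v == 0) = (v == 0).
Proof.
apply/eqP/eqP => [|->]; last exact: dotv0r.
rewrite dotvE => /psumr_eq0P h; apply/matrixP => i j; rewrite ord1 mxE.
have := h (fun i _ => sqr_ge0 (v i 0)) i isT.
by move/eqP; rewrite mulf_eq0 orbb => /eqP.
Qed.

Lemma enorm_ge0 n (v : 'cV[R]_n) : 0 <= enorm v.
Proof. exact: sqrtr_ge0. Qed.

Lemma enorm_sqr n (v : 'cV[R]_n) : enorm v ^+ 2 = dotv v v.
Proof. by rewrite sqr_sqrtr// dotvv_ge0. Qed.

Lemma enorm_eq0 n (v : 'cV[R]_n) : (enorm v == 0) = (v == 0).
Proof. by rewrite -sqrf_eq0 enorm_sqr dotvv_eq0. Qed.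

Lemma enorm_gt0 n (v : 'cV[R]_n) : (0 < enorm v) = (v != 0).
Proof. by rewrite lt_def enorm_ge0 andbT enorm_eq0. Qed.

Lemma enorm0 n : enorm (0 : 'cV[R]_n) = 0.
Proof. by apply/eqP; rewrite enorm_eq0. Qed.

Lemma enormZ n a (v : 'cV[R]_n) : enorm (a *: v) = `|a| * enorm v.
Proof.
by rewrite /enorm dotvZl dotvZr mulrA -expr2 sqrtrM ?sqr_ge0// sqrtr_sqr.
Qed.

Lemma enormN n (v : 'cV[R]_n) : enorm (- v) = enorm v.
Proof. by rewrite -scaleN1r enormZ normrN1 mul1r. Qed.

Lemma enormC n (u v : 'cV[R]_n) : enorm (u - v) = enorm (v - u).
Proof. by rewrite -enormN opprB. Qed.

Lemma enorm_unitv n (v : 'cV[R]_n) : v != 0 -> enorm (unitv v) = 1.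
Proof.
move=> v0; rewrite /unitv enormZ ger0_norm ?invr_ge0 ?enorm_ge0//.
by rewrite mulVf// enorm_eq0.
Qed.

Lemma cauchy_schwarz n (u v : 'cV[R]_n) : `|dotv u v| <= enorm u * enorm v.
Proof.
have [->|v0] := eqVneq v 0; first by rewrite dotv0r enorm0 mulr0 normr0.
have vv0 : 0 < dotv v v by rewrite lt_def dotvv_ge0 dotvv_eq0 v0.
rewrite -ler_sqr ?nnegrE ?mulr_ge0 ?enorm_ge0//.
rewrite exprMn !enorm_sqr real_normK ?num_real//.
(* The component of [u] orthogonal to [v], cleared of denominators. *)
have := dotvv_ge0 (dotv v v *: u - dotv u v *: v).
rewrite dotvBl !dotvBr !dotvZl !dotvZr [dotv v u]dotvC => h.
by rewrite -subr_ge0 -(pmulr_rge0 _ vv0); apply: le_trans h _; lra.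
Qed.

Lemma enormD n (u v : 'cV[R]_n) : enorm (u + v) <= enorm u + enorm v.
Proof.
rewrite -ler_sqr ?nnegrE ?addr_ge0 ?enorm_ge0//.
rewrite sqrrD !enorm_sqr dotvDl !dotvDr [dotv v u]dotvC.
have := cauchy_schwarz u v; rewrite ler_norml => /andP[_ h]; lra.
Qed.

Lemma mx_coord_le n (v : 'cV[R]_n) i : `|v i 0| <= `|v|.
Proof.
rewrite -[leRHS]/(mx_norm v) mx_normrE.
by apply/bigmax_geP; right; exists (i, 0).
Qed.

Lemma mx_norm_le n (v : 'cV[R]_n) c :
  0 <= c -> (forall i, `|v i 0| <= c) -> `|v| <= c.
Proof.
move=> c0 h; rewrite -[leLHS]/(mx_norm v) mx_normrE.
by apply/bigmax_leP; split=> // -[i j] _ /=; rewrite ord1.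
Qed.

Lemma norm_dotv n (u v : 'cV[R]_n) : `|dotv u v| <= n%:R * `|u| * `|v|.
Proof.
rewrite dotvE (le_trans (ler_norm_sum _ _ _))//.
rewrite (le_trans (ler_sum _ (G := fun=> `|u| * `|v|) _))//.
  by move=> i _; rewrite normrM ler_pM ?mx_coord_le.
by rewrite sumr_const card_ord mulr_natl mulrnAl.
Qed.

Lemma norm_le_enorm n (v : 'cV[R]_n) : `|v| <= enorm v.
Proof.
apply: mx_norm_le => [|i]; first exact: enorm_ge0.
rewrite -ler_sqr ?nnegrE ?enorm_ge0// enorm_sqr real_normK ?num_real//.
rewrite dotvE (bigD1 i)//= -expr2 lerDl sumr_ge0// => j _.
by rewrite -expr2 sqr_ge0.
Qed.

Lemma enorm_le_norm n (v : 'cV[R]_n) : enorm v <= n%:R * `|v|.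
Proof.
rewrite -ler_sqr ?nnegrE ?mulr_ge0 ?enorm_ge0// enorm_sqr.
have := norm_dotv v v; rewrite (ger0_norm (dotvv_ge0 _)) => /le_trans; apply.
rewrite exprMn -mulrA -expr2 ler_wpM2r ?sqr_ge0// -natrX ler_nat.
by case: n v => // n _; rewrite -mulnn leq_pmulr.
Qed.

(** Gram-Schmidt: subtracting from [v] its projection [E *m (E^T *m v)] to the
    span treated so far leaves a nonzero vector, by freeness, whose direction
    becomes the new column. *)
Lemma orthonormal_span n (X : seq 'cV[R]_n) : free X ->
  exists E : 'M[R]_(n, size X), E^T *m E = 1%:M /\
    forall v, v \in <<X>>%VS <-> exists x, v = E *m x.
Proof.
elim: X => [_|v X IH].
  exists 0; split=> [|u]; first by apply/matrixP => -[].
  rewrite span_nil memv0; split=> [/eqP->|[x ->]]; last by rewrite mul0mx.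
  by exists 0; rewrite mul0mx.
rewrite free_cons => /andP[vX /IH[E [EE EX]]].
pose v' := v - E *m (E^T *m v).
have v'0 : v' != 0.
  rewrite subr_eq0; apply: contra vX => /eqP vE; apply/EX.
  by exists (E^T *m v).
have v'v' : enorm v' != 0 by rewrite enorm_eq0.
have Ev' : E^T *m v' = 0.
  by rewrite mulmxBr [E^T *m (E *m _)]mulmxA EE mul1mx subrr.
have uE : (unitv v')^T *m E = 0.
  by apply: trmx_inj; rewrite trmx_mul trmxK trmx0 -scalemxAr Ev' scaler0.
rewrite -[size (v :: X)]/(1 + size X)%N.
exists (row_mx (unitv v') E); split=> [|u].
  have Eu : E^T *m unitv v' = 0 by rewrite -scalemxAr Ev' scaler0.
  rewrite tr_row_mx mul_col_row EE uE Eu.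
  suff -> : (unitv v')^T *m unitv v' = 1%:M :> 'M[R]_1.
    by rewrite scalar_mx_block.
  apply/matrixP => i j; rewrite !ord1 [RHS]mxE/=.
  by rewrite -[LHS]/(dotv _ _) -enorm_sqr enorm_unitv// expr1n.
rewrite span_cons; split=> [/memv_addP[_ /vlineP[a ->] [_ /EX[x ->] ->]]|[x ->]].
  exists (col_mx (a * enorm v')%:M (x + a *: (E^T *m v))).
  rewrite mul_row_col mulmxDr -scalemxAr mul_mx_scalar /unitv scalerA.
  by rewrite mulfK// /v' scalerBr addrACA addNr addr0.
rewrite -[x]vsubmxK mul_row_col.
have -> : usubmx x = (usubmx x 0 0)%:M by exact: mx11_scalar.
rewrite mul_mx_scalar /unitv scalerA /v' scalerBr -addrA.
apply: memv_add; first by rewrite memvZ// memv_line.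
by apply/EX; eexists; rewrite scalemxAr -mulmxN -mulmxDr.
Qed.

Lemma orthonormal_basis n (L : {vspace 'cV[R]_n}) :
  exists E : 'M[R]_(n, \dim L), E^T *m E = 1%:M /\
    forall v, v \in L <-> exists x, v = E *m x.
Proof.
have /orthonormal_span := basis_free (vbasisP L).
by rewrite size_tuple (span_basis (vbasisP L)).
Qed.

Lemma dotv_continuous d (v : 'cV[R]_d) :
  continuous (fun x : 'cV[R]_d => dotv x v).
Proof.
move=> y; apply/(@cvgrPdist_le _ _ _ (nbhs y)) => e e0.
pose M := d%:R * `|v| + 1.
have M0 : 0 < M by rewrite ltr_wpDl ?mulr_ge0.
apply/nbhs_ballP; exists (e / M) => [|y'] /=; first exact: divr_gt0.
rewrite mx_norm_ball /ball_/= => /ltW h.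
rewrite -dotvBl (le_trans (norm_dotv _ _))//.
move: h; rewrite ler_pdivlMr//; apply: le_trans.
by rewrite mulrAC mulrC ler_wpM2l// lerDl.
Qed.

(** Baire's theorem, for the complete normed space packed from the completeness
    and the norm of column vectors. *)
Lemma Baire_cV n (F : nat -> set 'cV[R]_n) :
  (forall i, open (F i) /\ dense (F i)) -> dense (\bigcap_i F i).
Proof.
pose U : completeNormedModType R := HB.pack_for (completeNormedModType R)
  (matrix R n 1) (Complete.class (matrix R n 1 : completeType)).
exact: (@Baire R U).
Qed.

Lemma increasing_homo (h : nat -> nat) : (forall k, (h k < h k.+1)%N) ->
  forall i j, (i < j)%N -> (h i < h j)%N.
Proof. by move=> hh i j; apply: (homo_ltn (@ltn_trans) hh). Qed.

Lemma increasing_ge_id (h : nat -> nat) : (forall k, (h k < h k.+1)%N) ->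
  forall k, (k <= h k)%N.
Proof. by move=> hh; elim=> // k IH; exact: leq_ltn_trans IH (hh k). Qed.

Lemma increasing_cvg (h : nat -> nat) : (forall k, (h k < h k.+1)%N) ->
  h @ \oo --> \oo.
Proof.
move=> hh A [N _ NA]; exists N => // k /= Nk; apply: NA => /=.
exact: leq_trans Nk (increasing_ge_id hh k).
Qed.

Lemma cvg_coord n (u : nat -> 'cV[R]_n) (l : 'cV[R]_n) :
  (forall i, (fun k => u k i 0) @ \oo --> l i 0) -> u @ \oo --> l.
Proof.
move=> h; apply/cvgrPdist_le => e e0.
have : \forall k \near \oo, forall i, `|l i 0 - u k i 0| <= e.
  by apply: filter_forall => i; move: (h i) => /cvgrPdist_le; apply.
apply: filterS => k kl; apply: mx_norm_le => [|i]; first exact: ltW.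
by rewrite !mxE.
Qed.

(** Subsequences are extracted one coordinate after the other. *)
Lemma bolzano_cV n (u : nat -> 'cV[R]_n) M : (forall k, `|u k| <= M) ->
  exists2 h : nat -> nat, (forall k, (h k < h k.+1)%N) & cvgn (u \o h).
Proof.
move=> uM.
have [h hi hc] : exists2 h : nat -> nat, (forall k, (h k < h k.+1)%N) &
    forall i : 'I_n, (i < n)%N -> cvgn (fun k => u (h k) i 0).
  suff: forall j, (j <= n)%N ->
    exists2 h : nat -> nat, (forall k, (h k < h k.+1)%N) &
    forall i : 'I_n, (i < j)%N -> cvgn (fun k => u (h k) i 0) by apply.
  elim=> [|j IH] jn; first by exists id.
  have [h hi hc] := IH (ltnW jn).
  have [|h' /increasing_seqP h'o h'c] :=
      @bolzano_weierstrass R (fun k => u (h k) (Ordinal jn) 0).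
    exists M; split; first exact: num_real.
    move=> x Mx k _ /=.
    by rewrite (le_trans (mx_coord_le _ _))// (le_trans (uM _))// ltW.
  have h'i k : (h' k < h' k.+1)%N by have := h'o k; rewrite ltEnat.
  exists (h \o h'); first by move=> k; exact: increasing_homo hi _ _ (h'i k).
  move=> i; rewrite ltnS leq_eqVlt => /orP[/eqP ij|ij].
    by have -> : i = Ordinal jn by exact: val_inj.
  apply/cvg_ex; have /cvg_ex[l hl] := hc _ ij; exists l.
  exact: cvg_comp (increasing_cvg h'i) hl.
exists h => //; apply/cvg_ex.
exists (\col_i limn (fun k => u (h k) i 0)).
by apply: cvg_coord => i; rewrite mxE; exact: hc.
Qed.
End Euclid.

(** * Transference *)

(** The constant [kappa] may depend on the sequence; this freedom is needed
    because the strategies in the game only reach a constant depending on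
    [beta]. *)
Definition often_far (R : realType) (t : nat -> R) : Prop :=
  exists2 kappa : R, 0 < kappa &
    forall N, exists2 k, (N <= k)%N & forall z : int, kappa <= `|t k - z%:~R|.

Section IntDist.
Variable R : realType.

Lemma far_in_gap (t delta : R) (z0 : int) :
  z0%:~R + delta <= t -> t <= z0%:~R + 1 - delta ->
  forall z : int, delta <= `|t - z%:~R|.
Proof.
move=> lo up z; rewrite ler_normr; have [zz0|zz0] := lerP z z0.
  have : z%:~R <= z0%:~R :> R by rewrite ler_int.
  by move=> h; apply/orP; left; lra.
have : z0%:~R + 1 <= z%:~R :> R by rewrite -intrD1 ler_int lezD1.
by move=> h; apply/orP; right; lra.
Qed.

Lemma int_dist_le k (v : 'cV[R]_k) p : int_dist v <= `|v - intv R p|.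
Proof. by apply: ge_inf; [exists 0 => _ [q _ <-] | exists p]. Qed.

Lemma int_dist_ge k (v : 'cV[R]_k) c :
  (forall p, c <= `|v - intv R p|) -> c <= int_dist v.
Proof.
move=> h; apply: lb_le_inf; first by exists `|v - intv R 0|; exists 0.
by move=> _ [p _ <-].
Qed.

Lemma int_dist_ge0 k (v : 'cV[R]_k) : 0 <= int_dist v.
Proof. exact: int_dist_ge. Qed.

(** Allows passing to the infimum in one integer vector at a time. *)
Lemma le_int_dist k (v : 'cV[R]_k) a b c : 0 <= b ->
  (forall p, a <= b * `|v - intv R p| + c) -> a <= b * int_dist v + c.
Proof.
rewrite le_eqVlt => /orP[/eqP<- /(_ 0)|b0 h]; first by rewrite !mul0r.
rewrite -lerBlDr -ler_pdivrMl//; apply: int_dist_ge => p.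
by rewrite ler_pdivrMl// lerBlDr.
Qed.

Lemma dotv_intv k (p q : 'cV[int]_k) :
  exists z : int, dotv (intv R p) (intv R q) = z%:~R.
Proof.
exists (\sum_i p i 0 * q i 0); rewrite dotvE rmorph_sum/=.
by apply: eq_bigr => i _; rewrite !mxE rmorphM.
Qed.

(** Up to an integer, [eta . y] is
    [q . (Theta^T y - p') - y . (Theta q - eta - p)] for all integer [p], [p'];
    both terms are bounded through the sup norm, then [p] and [p'] are
    optimized separately. *)
Lemma transference n m (Theta : 'M[R]_(n, m)) (eta : 'cV[R]_n)
    (y : 'cV[int]_n) (q : 'cV[int]_m) kappa :
  (forall z : int, kappa <= `|dotv eta (intv R y) - z%:~R|) ->
  kappa <= n%:R * `|intv R y| * int_dist (Theta *m intv R q - eta)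
    + m%:R * `|intv R q| * int_dist (Theta^T *m intv R y).
Proof.
move=> far; apply: le_int_dist => [|p]; first by rewrite mulr_ge0.
rewrite addrC; apply: le_int_dist => [|p']; first by rewrite mulr_ge0.
have [a ha] := dotv_intv p' q; have [b hb] := dotv_intv y p.
apply: le_trans (far (a - b)) _.
have -> : dotv eta (intv R y) - (a - b)%:~R =
    dotv (intv R q) (Theta^T *m intv R y - intv R p')
      - dotv (intv R y) (Theta *m intv R q - eta - intv R p).
  rewrite rmorphB/= -ha -hb !dotvBr dotv_mulmxr [dotv eta _]dotvC.
  by rewrite [dotv _ (intv R p')]dotvC [dotv (_ *m _) _]dotvC trmxK; lra.
by rewrite (le_trans (ler_normB _ _))// lerD// norm_dotv.
Qed.

(** With [g T = 1 / finv (1 / T)], this bounds [g (c / f X)] by [C / X]. Taking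
    [C ^ gamma >= 1 / c], the growth condition gives [f X / c <= f (X / C)];
    since [f] tends to 0, the value [f X / c] is attained at some [Y], and
    [Y >= X / C] by monotonicity. *)
Lemma inverse_growth (f finv : R -> R) (c : R) :
  (forall t, 0 < t -> 0 < f t) ->
  (forall t, 0 < t -> {for t, continuous f}) ->
  (forall s t, 0 < s -> s < t -> f t < f s) ->
  (forall t, 0 < t -> finv (f t) = t) ->
  f t @[t --> +oo] --> (0 : R) ->
  (exists2 gamma : R, 0 < gamma &
    \forall C \near +oo, forall T, 0 < T -> f (C * T) <= C `^ (- gamma) * f T) ->
  0 < c ->
  exists2 C : R, 0 < C &
    forall X, 0 < X -> 1 / finv (1 / (c / f X)) <= C / X.
Proof.
move=> f_gt0 f_cont f_decr f_inv f_lim [gamma gamma0 [C0 [_ growth]]] c0.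
pose C := Num.max (C0 + 1) (Num.max 1 (c^-1 `^ gamma^-1)).
have C_gt0 : 0 < C by rewrite !lt_max ltr01 orbT.
have cC : c^-1 <= C `^ gamma.
  have -> : c^-1 = (c^-1 `^ gamma^-1) `^ gamma.
    by rewrite -powRrM mulVf ?gt_eqF// powRr1// invr_ge0 ltW.
  apply: ge0_ler_powR; rewrite ?nnegrE ?powR_ge0 ?(ltW gamma0) ?(ltW C_gt0)//.
  by rewrite /C !le_max lexx !orbT.
exists C => // X X0; rewrite invf_div.
have XC0 : 0 < X / C by exact: divr_gt0.
have s0 : 0 < f X / c by rewrite divr_gt0// f_gt0.
have sle : f X / c <= f (X / C).
  have := growth C _ (X / C) XC0.
  rewrite mulrCA mulfV ?gt_eqF// mulr1 => /(_ _).
  rewrite powRN mulrC ler_pdivlMr ?powR_gt0// => h.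
  apply: le_trans (h _); last by rewrite lt_max ltrDl ltr01.
  by rewrite ler_wpM2l// ltW// f_gt0.
have [M [_ hM]] : \forall t \near +oo, f t < f X / c.
  move/cvgrPdist_lt: f_lim => /(_ _ s0); apply: filterS => t.
  by rewrite sub0r normrN => /(le_lt_trans (ler_norm _)).
pose b := Num.max (X / C) (M + 1).
have bX : X / C <= b by rewrite le_max lexx.
have fb : f b < f X / c by apply: hM; rewrite lt_max ltrDl ltr01 orbT.
have [||Y] := @IVT R f (X / C) b (f X / c) bX.
- apply: continuous_in_subspaceT => t; rewrite inE/= in_itv/= => /andP[h _].
  exact/f_cont/(lt_le_trans XC0).
- by rewrite ge_min (ltW fb) orbT/= le_max sle.
rewrite in_itv/= => /andP[XY _] fY.
have Y0 : 0 < Y by exact: lt_le_trans XY.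
rewrite !mul1r -fY f_inv//.
by rewrite -[leRHS]invf_div lef_pV2 ?posrE.
Qed.

End IntDist.

Section NotSingular.
Variables (R : realType) (m n : nat) (m_gt0 : (0 < m)%N) (n_gt0 : (0 < n)%N).
Variables (f finv : R -> R).
Hypotheses (f_gt0 : forall t, 0 < t -> 0 < f t)
    (f_cont : forall t, 0 < t -> {for t, continuous f})
    (f_decr : forall s t, 0 < s -> s < t -> f t < f s)
    (f_inv : forall t, 0 < t -> finv (f t) = t)
    (f_lim : f t @[t --> +oo] --> (0 : R))
    (f_growth : exists2 gamma : R, 0 < gamma &
       \forall C \near +oo, forall T, 0 < T -> f (C * T) <= C `^ (- gamma) * f T).

(** If [eta] were singular, [e / (2 C)] as the approximation constant at height
    [T = c / f (|y k| ^ n)] would contradict [transference]: the constants [c]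
    and [e] are chosen so that each of the two terms there is compared with
    [kappa / 2]. *)
Lemma often_far_not_singular (Theta : 'M[R]_(n, m)) (y : nat -> 'cV[int]_n)
    (eta : 'cV[R]_n) :
  (forall k, int_dist (Theta^T *m intv R (y k)) ^+ m <= f (`|intv R (y k)| ^+ n)) ->
  `|intv R (y k)| @[k --> \oo] --> +oo ->
  often_far (fun k => dotv eta (intv R (y k))) ->
  (~` singular_hat Theta (fun T : R => 1 / finv (1 / T))) eta.
Proof.
move=> approx y_oo [kappa kappa0 far] sing.
pose c := (kappa / (2 * m%:R)) ^+ m.
pose e := (kappa / (2 * n%:R)) ^+ n.
have m0 : 0 < m%:R :> R by rewrite ltr0n.
have n0 : 0 < n%:R :> R by rewrite ltr0n.
have c0 : 0 < c by rewrite exprn_gt0// divr_gt0// mulr_gt0.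
have e0 : 0 < e by rewrite exprn_gt0// divr_gt0// mulr_gt0.
have [C C0 gC] := inverse_growth f_gt0 f_cont f_decr f_inv f_lim f_growth c0.
have [T0 [_ hT]] : \forall T \near +oo, exists q : 'cV[int]_m,
      [/\ q != 0, int_dist (Theta *m intv R q - eta) ^+ n <=
            (e / (2 * C)) * (1 / finv (1 / T)) & `|intv R q| ^+ m <= T].
  by apply: sing; rewrite divr_gt0// mulr_gt0.
pose T1 := Num.max T0 1.
have T1_gt0 : 0 < T1 by rewrite lt_max ltr01 orbT.
have [M [_ hM]] : \forall t \near +oo, f t < c / T1.
  have s0 : 0 < c / T1 by rewrite divr_gt0.
  move/cvgrPdist_lt: f_lim => /(_ _ s0); apply: filterS => t.
  by rewrite sub0r normrN => /(le_lt_trans (ler_norm _)).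
have [N _ hN] : \forall k \near \oo, Num.max 1 (M + 1) <= `|intv R (y k)|.
  by move/cvgryPge: y_oo; apply.
have [k Nk {}far] := far N.
have := hN k Nk; set Y := `|intv R (y k)|; rewrite ge_max => /andP[Y1 YM].
have Y0 : 0 < Y by exact: lt_le_trans ltr01 Y1.
have YnY : Y <= Y ^+ n by rewrite -{1}[Y]expr1 ler_weXn2l.
have Yn0 : 0 < Y ^+ n by rewrite exprn_gt0.
have fY0 := f_gt0 Yn0.
have fY : f (Y ^+ n) < c / T1.
  by apply: hM; apply: lt_le_trans YnY; apply: lt_le_trans YM; rewrite ltrDl ltr01.
have [|q [_ qd qT]] := hT (c / f (Y ^+ n)).
  have : T1 < c / f (Y ^+ n) by rewrite ltr_pdivlMr// mulrC -ltr_pdivlMr.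
  by rewrite gt_max => /andP[].
have := transference Theta q far; rewrite -/Y.
set d := int_dist _ in qd *; set d' := int_dist _ => tr.
have d0 : 0 <= d by exact: int_dist_ge0.
have d'0 : 0 <= d' by exact: int_dist_ge0.
have second : m%:R * `|intv R q| * d' <= kappa / 2.
  have : (`|intv R q| * d') ^+ m <= c.
    rewrite exprMn; apply: le_trans (_ : (c / f (Y ^+ n)) * f (Y ^+ n) <= _).
      by rewrite ler_pM ?exprn_ge0//; exact: approx.
    by rewrite divfK// gt_eqF.
  rewrite ler_pXn2r ?nnegrE ?divr_ge0 ?mulr_ge0 ?(ltW kappa0)//.
    by move=> h; rewrite -mulrA mulrC -ler_pdivlMr// (le_trans h)// invfM mulrA.
have first : kappa / (2 * n%:R) <= Y * d.
  rewrite invfM mulrA ler_pdivrMr// [leRHS]mulrC mulrA.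
  lra.
(* The bound from below and the approximation by [q] differ by a factor 2. *)
have : e <= e / 2.
  apply: le_trans (_ : Y ^+ n * d ^+ n <= _).
    by rewrite -exprMn lerXn2r ?nnegrE ?divr_ge0 ?mulr_ge0 ?(ltW kappa0) ?(ltW Y0).
  rewrite -ler_pdivlMl//; apply: le_trans qd _.
  apply: le_trans (_ : e / (2 * C) * (C / Y ^+ n) <= _).
    by rewrite ler_wpM2l ?gC// ltW// divr_gt0// mulr_gt0.
  have C_neq0 : C != 0 by rewrite gt_eqF.
  have Yn_neq0 : Y ^+ n != 0 by rewrite gt_eqF.
  rewrite le_eqVlt; apply/orP; left; apply/eqP; field.
  by rewrite Yn_neq0 C_neq0.
by rewrite leNgt ltr_pdivrMr// ltr_pMr// ltr1n.
Qed.

End NotSingular.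

(** * The hyperplane absolute game *)

Section Game.
Import Defs.
Variables (R : realType) (d : nat) (d_gt0 : (0 < d)%N).

Lemma const_neq0 : const_mx 1 != 0 :> 'cV[R]_d.
Proof.
apply/eqP => /matrixP /(_ (Ordinal d_gt0) 0) /eqP.
by rewrite !mxE oner_eq0.
Qed.

(** Inclusion of Euclidean balls controls the centers: test it at the point of
    the small ball that is farthest from the center of the large one. *)
Lemma nested_balls (b b' : ball_data R d) : 0 <= radius b' ->
  closed_ball_set b' `<=` closed_ball_set b ->
  enorm (center b' - center b) <= radius b - radius b'.
Proof.
move=> r'0 sub.
pose v := center b' - center b.
have [u u1 vu] : exists2 u : 'cV[R]_d, enorm u = 1 & v = enorm v *: u.
  have [v0|v0] := eqVneq v 0.
    exists (unitv (const_mx 1)); first exact/enorm_unitv/const_neq0.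
    by rewrite v0 enorm0 scale0r.
  exists (unitv v); first exact: enorm_unitv.
  by rewrite /unitv scalerA mulfV ?scale1r// enorm_eq0.
have : closed_ball_set b (center b' + radius b' *: u).
  apply: sub; rewrite /closed_ball_set/= addrAC subrr add0r enormZ u1 mulr1.
  by rewrite ger0_norm.
rewrite /closed_ball_set/= addrAC -/v [in v + _]vu -scalerDl enormZ u1 mulr1.
by rewrite ger0_norm ?addr_ge0 ?enorm_ge0// lerBrDr.
Qed.

(** The centers move by at most the decrease of the radii, hence converge, and
    the ball of radius [r] around their limit lies in all the balls. This also
    covers plays in which the radii do not tend to 0. *)
Lemma nested_balls_limit (B : nat -> ball_data R d) :
  (forall i, 0 <= radius (B i)) ->
  (forall i, closed_ball_set (B i.+1) `<=` closed_ball_set (B i)) ->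
  exists (x : 'cV[R]_d) (r : R), [/\ 0 <= r,
    radius (B i) @[i --> \oo] --> r,
    forall i, r <= radius (B i) &
    forall i, enorm (x - center (B i)) <= radius (B i) - r].
Proof.
move=> r0 sub.
have subij i j : (i <= j)%N -> closed_ball_set (B j) `<=` closed_ball_set (B i).
  elim: j => [|j IH]; first by rewrite leqn0 => /eqP->.
  rewrite leq_eqVlt => /orP[/eqP->//|ij].
  by apply: subset_trans (IH ij); exact: sub.
have cij i j : (i <= j)%N ->
    enorm (center (B j) - center (B i)) <= radius (B i) - radius (B j).
  by move=> ij; apply: nested_balls => //; exact: subij.
have rdec : nonincreasing_seq (fun i => radius (B i)).
  by move=> i j /cij h; rewrite -subr_ge0 (le_trans _ h)// enorm_ge0.
have rcvg : cvgn (fun i => radius (B i)).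
  by apply: nonincreasing_is_cvgn => //; exists 0 => _ [i _ <-].
set r := limn (fun i => radius (B i)).
have r_le i : r <= radius (B i) by exact: nonincreasing_cvgn_ge.
have c_cvg : cvgn (fun i => center (B i)).
  apply/cauchy_cvgP/cauchy_exP => e e0.
  have [N _ hN] : \forall i \near \oo, `|r - radius (B i)| < e.
    by move/cvgrPdist_lt: rcvg; apply.
  exists (center (B N)); exists N => // i /= Ni.
  rewrite mx_norm_ball /ball_/= (le_lt_trans (norm_le_enorm _))//.
  rewrite enormC (le_lt_trans (cij _ _ Ni))//.
  have := hN N (leqnn N); rewrite distrC ger0_norm ?subr_ge0//.
  by apply: le_lt_trans; rewrite lerD2l lerN2.
exists (limn (fun i => center (B i))), r; split=> //.
  by apply: limr_ge => //; exact: nearW.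
move=> i; apply/ler_addgt0Pr => e e0.
have e'0 : 0 < e / d%:R by rewrite divr_gt0// ltr0n.
have [N _ hN] : \forall j \near \oo,
    `|limn (fun i => center (B i)) - center (B j)| <= e / d%:R.
  by move/cvgrPdist_le: c_cvg; apply.
set x := limn _ in hN *; pose j := maxn i N.
have -> : x - center (B i) = (x - center (B j)) + (center (B j) - center (B i)).
  by rewrite addrA addrNK.
rewrite (le_trans (enormD _ _))// addrC lerD//.
  by rewrite (le_trans (cij _ _ (leq_maxl _ _)))// lerD2l lerN2.
rewrite (le_trans (enorm_le_norm _))// mulrC -ler_pdivlMr ?ltr0n//.
exact/hN/leq_maxr.
Qed.

(** The distance from [x] to the hyperplane is attained at the orthogonal
    projection. *)
Lemma avoids_hyperplane (a : hyperplane_move R d) x : normal a != 0 ->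
  ~ removed a x -> width a * enorm (normal a) <= `|dotv x (normal a) - offset a|.
Proof.
case: a => w o e /= w0 nx; rewrite leNgt; apply/negP => h; apply: nx.
have ww0 : dotv w w != 0 by rewrite dotvv_eq0.
pose t := (dotv x w - o) / dotv w w.
exists (x - t *: w); first by rewrite /hyperplane/= dotvBl dotvZl divfK// subKr.
rewrite opprB addrC addrNK enormZ normrM normfV (ger0_norm (dotvv_ge0 _)).
have W0 : 0 < enorm w by rewrite enorm_gt0.
rewrite /= -enorm_sqr -mulrA expr2 invfM -mulrA mulVf ?mulr1 ?gt_eqF//.
by rewrite ltr_pdivrMr.
Qed.

Variables (w : nat -> 'cV[R]_d) (b : nat -> R).
Hypothesis w_oo : enorm (w k) @[k --> \oo] --> +oo.

(** For each [N] the points at which some form with index [k >= N] is at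
    distance more than 1/4 from the integers form an open set, which is dense
    because moving by at most [2 / enorm (w k)] along [w k] brings the form to a half
    integer. Baire's theorem gives points that lie in all these sets. *)
Lemma often_far_dense x r : 0 < r -> exists2 x', enorm (x' - x) <= r &
  often_far (fun k => dotv x' (w k) + b k).
Proof.
move=> r0.
pose U k := \bigcup_(z in [set: int])
  [set x | z%:~R + 4^-1 < dotv x (w k) + b k < z%:~R + 3 / 4].
pose F N := \bigcup_(k in [set k | (N <= k)%N]) U k.
have Fopen N : open (F N).
  apply: bigcup_open => k _; apply: bigcup_open => z _.
  have -> : [set x | z%:~R + 4^-1 < dotv x (w k) + b k < z%:~R + 3 / 4] =
      (fun x => dotv x (w k) + b k) @^-1` `]z%:~R + 4^-1, z%:~R + 3 / 4[%classic.
    by apply/seteqP; split=> y /=; rewrite in_itv.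
  apply: open_comp => [y _|]; last exact: interval_open.
  exact: (cvgD (@dotv_continuous _ _ (w k) y) (cvg_cst (b k))).
have Fdense N : dense (F N).
  move=> O [y Oy] Oopen.
  have /nbhs_ballP[e /= e0 eO] : nbhs y O by exact: open_nbhs_nbhs.
  have [K _ hK] : \forall k \near \oo, 2 / e + 1 <= enorm (w k).
    by move/cvgryPge: w_oo; apply.
  pose k := maxn N K.
  have wk : 2 / e < enorm (w k).
    by apply: lt_le_trans (hK k (leq_maxr _ _)); rewrite ltrDl.
  have w0 : 0 < enorm (w k) by apply: le_lt_trans wk; rewrite divr_ge0// ltW.
  pose t := dotv y (w k) + b k.
  (* Aiming above the next integer makes [s] nonnegative and at most 3/2. *)
  pose s := (Num.floor t)%:~R + 3 / 2 - t.
  have [f1 f2] : t < (Num.floor t)%:~R + 1 /\ (Num.floor t)%:~R <= t.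
    by have /andP[? ?] := floor_itv t; rewrite -intrD1.
  pose y' := y + (s / dotv (w k) (w k)) *: w k.
  exists y'; split.
    apply: eO; rewrite mx_norm_ball /ball_/= opprD addrA subrr add0r normrN.
    rewrite (le_lt_trans (norm_le_enorm _))// enormZ normrM normfV.
    rewrite (ger0_norm (dotvv_ge0 _)) -enorm_sqr -mulrA expr2 invfM -mulrA.
    rewrite mulVf ?gt_eqF// mulr1 ltr_pdivrMr// ger0_norm; last by rewrite /s; lra.
    move: wk; rewrite ltr_pdivrMr// mulrC; apply: le_lt_trans.
    by rewrite /s; lra.
  exists k; first exact: leq_maxl.
  exists (Num.floor t + 1) => //=.
  rewrite /y' dotvDl dotvZl divfK ?dotvv_eq0 -?enorm_gt0// addrAC -/t /s intrD1.
  by apply/andP; split; lra.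
have /Baire_cV FF : forall N, open (F N) /\ dense (F N) by [].
have [||x' [x'r Fx']] := FF (ball x (r / d%:R)).
- by exists x; apply: ballxx; rewrite divr_gt0// ltr0n.
- by apply: ball_open; rewrite divr_gt0// ltr0n.
exists x'.
  rewrite (le_trans (enorm_le_norm _))// mulrC -ler_pdivlMr ?ltr0n//.
  by move: x'r; rewrite mx_norm_ball /ball_/= distrC => /ltW.
exists 4^-1 => // N; have [k Nk [z _ /= /andP[h1 h2]]] := Fx' N I.
by exists k => //; apply: (@far_in_gap _ _ _ z); lra.
Qed.

(** The scale at which a ball of radius [r] sees the integer hyperplanes of the
    [k]-th form at mutual distance at least four radii, but not more than
    [4 / beta] radii. *)
Definition suitable (beta r : R) (k : nat) : Prop :=
  beta / 4 < r * enorm (w k) <= 4^-1.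

(** The rounded value [floor (t + 1/2)] is the integer closest to the value [t]
    of the form at the center. *)
Definition nearest_hyperplane (beta : R) (B : ball_data R d) (k : nat)
    : hyperplane_move R d :=
  HyperplaneMove (w k)
    ((Num.floor (dotv (center B) (w k) + b k + 2^-1))%:~R - b k)
    (beta * radius B).

(** Only the radius of the current ball matters. When no index is suitable, any
    legal move will do. *)
Definition hyperplane_strategy (beta : R) : strategy R d := fun _ B =>
  if pselect (exists k, suitable beta (radius B) k) is left h
  then nearest_hyperplane beta B (projT1 (cid h))
  else HyperplaneMove (const_mx 1) 0 (beta * radius B).

Lemma suitable_neq0 beta r k : 0 < beta -> 0 < r -> suitable beta r k ->
  w k != 0.
Proof.
move=> beta0 r0 /andP[h _]; rewrite -enorm_gt0 -(pmulr_rgt0 _ r0).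
by apply: lt_trans h; rewrite divr_gt0.
Qed.

(** On the ball the form varies by at most 1/4 around its value at the center,
    so it stays 1/4 away from all integers but the nearest one; the deleted
    neighborhood, of width [beta r], keeps it [beta r enorm (w k)] away from
    that one. *)
Lemma nearest_hyperplane_far beta (B : ball_data R d) k x :
  0 < beta < 3^-1 -> 0 < radius B -> suitable beta (radius B) k ->
  closed_ball_set B x -> ~ removed (nearest_hyperplane beta B k) x ->
  forall z : int, beta ^+ 2 / 4 <= `|dotv x (w k) + b k - z%:~R|.
Proof.
move=> /andP[beta0 beta3] r0 suit Bx nx z.
have w0 := suitable_neq0 beta0 r0 suit.
have := @avoids_hyperplane (nearest_hyperplane beta B k) x w0 nx; rewrite /= opprB addrA.
set t := dotv (center B) (w k) + b k; set z0 := Num.floor _ => far.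
have /andP[s1 s2] := suit.
have [f1 f2] : t + 2^-1 < z0%:~R + 1 /\ z0%:~R <= t + 2^-1.
  by have /andP[? ?] := floor_itv (t + 2^-1); rewrite -intrD1.
have [->|zz0] := eqVneq z z0.
  apply: le_trans far; rewrite expr2 -!mulrA ler_wpM2l//; first exact: ltW.
  exact: ltW.
have xt : `|dotv x (w k) + b k - t| <= 4^-1.
  rewrite /t opprD addrACA subrr addr0 -dotvBl.
  rewrite (le_trans (cauchy_schwarz _ _))// (le_trans _ s2)//.
  by rewrite ler_wpM2r// enorm_ge0.
have bb : beta ^+ 2 / 4 <= 4^-1.
  by rewrite ler_piMl// expr_le1 ?ltW//; lra.
apply: le_trans bb _; move: xt; rewrite ler_norml => /andP[x1 x2].
move: zz0; rewrite neq_lt => /orP[zz0|zz0].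
  have : z%:~R + 1 <= z0%:~R :> R by rewrite -intrD1 ler_int lezD1.
  by move=> h; rewrite ler_normr; apply/orP; left; lra.
have : z0%:~R + 1 <= z%:~R :> R by rewrite -intrD1 ler_int lezD1.
by move=> h; rewrite ler_normr; apply/orP; right; lra.
Qed.

(** If Bob's radii tend to 0, any index [k] is suitable at finitely many stages
    only, whereas each large [k] is suitable at some stage, by the lower bound
    on the shrinking; so Alice deals with infinitely many indices. If not, the
    balls have a common ball and [often_far_dense] applies. *)
Theorem HAW_often_far : HAW [set x | often_far (fun k => dotv x (w k) + b k)].
Proof.
move=> beta beta_itv; have /andP[beta0 beta3] := beta_itv.
exists (hyperplane_strategy beta); split=> [past B r0|B r0 legal].
  rewrite /hyperplane_strategy/alice_legal; case: pselect => [h|_] /=.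
    by rewrite lexx mulr_gt0//; split=> //; apply: suitable_neq0 (projT2 (cid h)).
  by rewrite lexx mulr_gt0// const_neq0.
have r_gt0 i : 0 < radius (B i).
  elim: i => // i IH; have [_ _] := legal i; apply: lt_le_trans.
  by rewrite mulr_gt0.
have sub i : closed_ball_set (B i.+1) `<=` closed_ball_set (B i).
  by have [] := legal i.
have [|x [r [rge0 r_cvg r_le xr]]] := nested_balls_limit _ sub.
  by move=> i; exact: ltW.
have inB y : enorm (y - x) <= r -> forall i, closed_ball_set (B i) y.
  move=> yx i; rewrite /closed_ball_set/=.
  have -> : y - center (B i) = (y - x) + (x - center (B i)).
    by rewrite addrA addrNK.
  by rewrite (le_trans (enormD _ _))// addrC -lerBrDr (le_trans (xr i))// lerD2l lerN2.
move: rge0; rewrite le_eqVlt => /orP[/eqP r_eq0|rpos]; last first.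
  have [y yx yfar] := often_far_dense x rpos.
  by exists y; split=> // i _; exact: inB.
have xB : forall i, closed_ball_set (B i) x by apply: inB; rewrite subrr enorm0 -r_eq0.
exists x; split; last by move=> i _; exact: xB.
exists (beta ^+ 2 / 4); first by rewrite divr_gt0 ?exprn_gt0.
have rdec : nonincreasing_seq (fun i => radius (B i)).
  apply/nonincreasing_seqP => i.
  have h := nested_balls (ltW (r_gt0 i.+1)) (@sub i).
  by rewrite -subr_ge0 (le_trans _ h)// enorm_ge0.
move=> N.
(* From the stage [I0] on, suitable indices are at least [N]. *)
have [I0 hI0] : exists I0, forall k, (k < N)%N ->
    radius (B I0) * enorm (w k) <= beta / 4.
  have : \forall i \near \oo, forall k : 'I_N,
      radius (B i) * enorm (w k) <= beta / 4.
    apply: filter_forall => k.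
    have e0 : 0 < beta / 4 / (enorm (w k) + 1).
      by rewrite !divr_gt0// ltr_wpDl ?enorm_ge0.
    move/cvgrPdist_le: r_cvg => /(_ _ e0); apply: filterS => i.
    rewrite -r_eq0 sub0r normrN ger0_norm ?(ltW (r_gt0 i))//.
    rewrite ler_pdivlMr ?ltr_wpDl ?enorm_ge0//; apply: le_trans.
    by rewrite ler_wpM2l ?lerDl// ltW.
  by move=> [I0 _ hI0]; exists I0 => k kN; apply: (hI0 I0 _ (Ordinal kN)) => /=.
have [k0 hk0] : exists k0, 4^-1 < radius (B I0) * enorm (w k0).
  have [K _ hK] : \forall k \near \oo, (4 * radius (B I0))^-1 + 1 <= enorm (w k).
    by move/cvgryPge: w_oo; apply.
  exists K; rewrite mulrC -ltr_pdivrMr//.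
  by apply: lt_le_trans (hK K (leqnn K)); rewrite invfM ltrDl.
(* The first stage at which the ball is small enough for [k0] is suitable: one
   stage before, the ball was still too large, and it shrank by at most
   [beta]. *)
have [i [Ii suit]] : exists i, (I0 <= i)%N /\ suitable beta (radius (B i)) k0.
  have ex : exists i, radius (B (I0 + i)%N) * enorm (w k0) <= 4^-1.
    have w0 : 0 < enorm (w k0).
      by rewrite -(pmulr_rgt0 _ (r_gt0 I0)); apply: lt_trans hk0.
    have e0 : 0 < 4^-1 / enorm (w k0) by rewrite divr_gt0.
    move/cvgrPdist_le: r_cvg => /(_ _ e0) [i _ hi].
    exists i; rewrite -ler_pdivlMr//; have := hi (I0 + i)%N (leq_addl _ _).
    by rewrite -r_eq0 sub0r normrN ger0_norm// ltW.
  case: (ex_minnP ex) => -[|i] hi mini; first by move: hi; rewrite addn0 leNgt hk0.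
  exists (I0 + i.+1)%N; split; first exact: leq_addr.
  apply/andP; split=> //.
  have : 4^-1 < radius (B (I0 + i)%N) * enorm (w k0).
    by rewrite ltNge; apply/negP => /mini; rewrite ltnn.
  move=> h; have [_ _] := legal (I0 + i)%N; rewrite -addnS => hr.
  apply: (@lt_le_trans _ _ (beta * (radius (B (I0 + i)%N) * enorm (w k0)))).
    by rewrite ltr_pM2l.
  by rewrite mulrA ler_wpM2r// enorm_ge0.
have [_ + _] := legal i; rewrite /hyperplane_strategy.
case: pselect => [h|/(_ (ex_intro _ k0 suit))//].
case: (cid h) => k suitk /= dis.
exists k.
  rewrite leqNgt; apply/negP => kN; have := hI0 k kN.
  have /andP[+ _] := suitk; move=> /lt_le_trans h1 h2.
  have : radius (B i) * enorm (w k) <= beta / 4.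
    by apply: le_trans h2; rewrite ler_wpM2r ?enorm_ge0// rdec.
  by move/h1; rewrite ltxx.
apply: nearest_hyperplane_far suitk (xB i) _ => // rem.
have : (closed_ball_set (B i.+1) `&` removed (nearest_hyperplane beta (B i) k)) x.
  by split=> //; exact: xB.
by rewrite dis.
Qed.

End Game.

(** * Integer vectors *)

Section IntegerVectors.
Variable R : realType.

Lemma finite_bounded_intv n (M : R) :
  finite_set [set x : 'cV[int]_n | `|intv R x| <= M].
Proof.
pose N := Num.bound M.
pose h (c : 'cV['I_(N + N).+1]_n) : 'cV[int]_n :=
  \col_i ((c i 0 : nat)%:Z - N%:Z).
apply: (@sub_finite_set _ _ (range h)); last exact: finite_image finite_finset.
move=> x /= xM.
have M0 : 0 <= M by exact: le_trans xM.
have xN i : (`|x i 0| < N%:Z)%R.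
  rewrite -(ltr_int R) intr_norm; apply: le_lt_trans (archi_boundP M0).
  by apply: le_trans xM; have := mx_coord_le (intv R x) i; rewrite mxE.
exists (\col_i inord (absz (x i 0 + N%:Z))) => //.
apply/matrixP => i j; rewrite ord1 !mxE.
have := xN i; rewrite ltr_norml => /andP[h1 h2].
have x0 : 0 <= x i 0 + N%:Z by rewrite -lerBlDr sub0r ltW.
rewrite inordK; first by rewrite gez0_abs// addrK.
by rewrite ltnS -lez_nat gez0_abs// PoszD lerD2r ltW.
Qed.

Lemma infinite_intv_cvg n (A : set 'cV[int]_n) : infinite_set A ->
  exists2 y : nat -> 'cV[int]_n, (forall k, A (y k)) &
    `|intv R (y k)| @[k --> \oo] --> +oo.
Proof.
move=> Aoo.
have : forall k : nat, exists x, A x /\ k%:R < `|intv R x|.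
  move=> k; have [x [Ax /negP]] :=
    infinite_setN0 (infinite_setD Aoo (finite_bounded_intv n k%:R)).
  by rewrite -ltNge => kx; exists x.
move=> /choice[y yP]; exists y => [k|]; first by have [] := yP k.
apply/cvgryPge => M; near=> k; apply: le_trans (_ : k%:R <= _).
  by near: k; exact: nbhs_infty_ger.
by apply/ltW; have [] := yP k.
Unshelve. all: by end_near. Qed.

Lemma cvgy_mulSn (c : R) : 0 < c -> k.+1%:R * c @[k --> \oo] --> +oo.
Proof.
move=> c0; apply/cvgryPge => M; near=> k; rewrite -ler_pdivrMr//.
apply: le_trans (_ : k%:R <= _); last by rewrite ler_nat.
by near: k; exact: nbhs_infty_ger.
Unshelve. all: by end_near. Qed.

(** If [t] is at distance [delta] from the integers, two consecutive multiples
    of [t] cannot both be within [delta / 2] of an integer. *)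
Lemma often_far_multiples (t : R) : (forall a : int, t <> a%:~R) ->
  often_far (fun k => k.+1%:R * t).
Proof.
move=> nt; have /andP[f1 f2] := floor_itv t; rewrite intrD1 in f2.
set z0 := Num.floor t in f1 f2.
have z0t : z0%:~R < t by rewrite lt_neqAle f1 andbT; apply/eqP => /esym /nt.
pose delta := Num.min (t - z0%:~R) (z0%:~R + 1 - t).
have delta0 : 0 < delta by rewrite lt_min !subr_gt0 z0t f2.
have far z : delta <= `|t - z%:~R|.
  have d1 : delta <= t - z0%:~R by rewrite ge_min lexx.
  have d2 : delta <= z0%:~R + 1 - t by rewrite ge_min lexx orbT.
  by apply: (@far_in_gap _ _ _ z0); lra.
exists (delta / 2); first by rewrite divr_gt0.
move=> N; have [h|] := pselect (forall z : int, delta / 2 <= `|N.+1%:R * t - z%:~R|).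
  by exists N.
move=> /existsNP[z /negP]; rewrite -ltNge => zN.
exists N.+1 => // z'; have := far (z' - z).
have -> : t - (z' - z)%:~R =
    (N.+2%:R * t - z'%:~R) - (N.+1%:R * t - z%:~R).
  by rewrite rmorphB/= -[N.+2]addn1 natrD; lra.
by move=> /le_trans/(_ (ler_normB _ _)); lra.
Qed.

Lemma frequently_subseq (P : nat -> Prop) :
  (forall N, exists2 k, (N <= k)%N & P k) ->
  exists2 h : nat -> nat, (forall k, (h k < h k.+1)%N) & forall k, P (h k).
Proof.
move=> freq.
have /choice[g gP] : forall N, exists k, (N <= k)%N /\ P k.
  by move=> N; have [k] := freq N; exists k.
exists (fun k => iter k (fun i => g i.+1) (g 0%N)) => [k|].
  by rewrite iterS; have [] := gP (iter k (fun i => g i.+1) (g 0%N)).+1.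
case=> [|k] /=; first by case: (gP 0%N).
by case: (gP (iter k (fun i => g i.+1) (g 0%N)).+1).
Qed.

End IntegerVectors.

(** * Best approximations *)

Section BestApproximations.
Variable R : realType.

Lemma norm_intv_lt_ge1 n (x y : 'cV[int]_n) : `|intv R x| < `|intv R y| ->
  `|intv R x| + 1 <= `|intv R y|.
Proof.
have nat_norm (z : 'cV[int]_n) : exists a : int, `|intv R z| = a%:~R.
  have [z0|z0] := eqVneq (mx_norm (intv R z)) 0; first by exists 0.
  have [i hi] := mx_norm_neq0 z0; exists `|z i.1 i.2|.
  by rewrite [LHS]hi mxE intr_norm.
have [a ->] := nat_norm x; have [b ->] := nat_norm y.
by rewrite ltr_int -intrD1 ler_int lezD1.
Qed.

Lemma best_approximations_ge m n (Phi : 'M[R]_(m, n)) (y : nat -> 'cV[int]_n) :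
  best_approximations Phi y -> forall nu, nu%:R <= `|intv R (y nu)|.
Proof.
move=> [_ y_incr _ _]; elim=> // nu IH; rewrite -natr1.
by apply: le_trans (norm_intv_lt_ge1 (y_incr nu)); rewrite lerD2r.
Qed.

Lemma best_approximations_cvgy m n (Phi : 'M[R]_(m, n))
    (y : nat -> 'cV[int]_n) :
  best_approximations Phi y -> `|intv R (y nu)| @[nu --> \oo] --> +oo.
Proof.
move=> /best_approximations_ge y_ge.
by apply: ger_cvgy (@cvgr_idn R); apply: nearW.
Qed.

(** A vector [x] realizing [f]-approximability may be replaced by the best
    approximation [y nu] with [|y nu| <= |x| < |y (nu + 1)|]: it is at least as
    good, and it is shorter, so that the bound by [f] gets weaker. *)
Lemma best_approximations_approx m n (Phi : 'M[R]_(m, n)) (f : R -> R)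
    (y : nat -> 'cV[int]_n) :
  (forall s t, 0 < s -> s < t -> f t < f s) ->
  approximable Phi f -> best_approximations Phi y ->
  forall N, exists2 nu, (N <= nu)%N &
    int_dist (Phi *m intv R (y nu)) ^+ m <= f (`|intv R (y nu)| ^+ n).
Proof.
move=> f_decr approx best N; have [y0 y_incr y_psi _] := best.
have y_mono i j : (i <= j)%N -> `|intv R (y i)| <= `|intv R (y j)|.
  elim: j => [|j IH]; first by rewrite leqn0 => /eqP->.
  rewrite leq_eqVlt => /orP[/eqP->//|ij].
  exact: le_trans (IH ij) (ltW (y_incr j)).
have y_ge := best_approximations_ge best.
have [x [[x_neq0 x_approx] /negP]] :=
  infinite_setN0 (infinite_setD approx (finite_bounded_intv n `|intv R (y N)|)).
rewrite -ltNge => xN.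
have ex : exists nu, `|intv R x| < `|intv R (y nu.+1)|.
  exists (Num.bound `|intv R x|); apply: lt_le_trans (y_ge _).
  by apply: lt_trans (archi_boundP (normr_ge0 _)) _; rewrite ltr_nat.
case: (ex_minnP ex) => nu x_lt nu_min.
have x_ge : `|intv R (y nu)| <= `|intv R x|.
  case: nu nu_min {x_lt} => [|nu] nu_min.
    by apply: ltW; apply: le_lt_trans xN; exact: y_mono.
  by rewrite leNgt; apply/negP => /nu_min; rewrite ltnn.
exists nu.
  rewrite leqNgt; apply/negP => nuN.
  have := lt_trans xN x_lt; rewrite ltNge => /negP; apply; exact: y_mono.
have ynu0 : 0 < `|intv R (y nu)|.
  by apply: lt_le_trans (y_mono 0%N nu (leq0n _)); rewrite y0.
have psi_x : int_dist (Phi *m intv R (y nu)) <= int_dist (Phi *m intv R x).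
  rewrite -(y_psi nu `|intv R x|) ?x_ge//; apply: ge_inf.
    by exists 0 => _ [z _ <-]; exact: int_dist_ge0.
  by exists x => //=; rewrite lexx andbT (lt_le_trans ynu0).
apply: le_trans (_ : int_dist (Phi *m intv R x) ^+ m <= _).
  by rewrite lerXn2r ?nnegrE ?int_dist_ge0.
apply: le_trans x_approx _.
have: `|intv R (y nu)| ^+ n <= `|intv R x| ^+ n by rewrite lerXn2r ?nnegrE.
rewrite le_eqVlt => /orP[/eqP->//|h].
by apply/ltW/f_decr => //; rewrite exprn_gt0.
Qed.

End BestApproximations.

(** * The game in an affine subspace *)

Section HAW_affine.
Import Defs.
Variable R : realType.

Lemma HAW_sub d (S S' : set 'cV[R]_d) : S `<=` S' -> HAW S -> HAW S'.
Proof.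
move=> SS' haw beta /haw[sigma [legal win]]; exists sigma; split=> // B r0 /(win B r0).
by case=> x [/SS' Sx Bx]; exists x.
Qed.

Lemma HAW_in_basis n (a0 : 'cV[R]_n) (L : {vspace 'cV[R]_n})
    (E : 'M[R]_(n, \dim L)) (S : set 'cV[R]_n) :
  E^T *m E = 1%:M -> (forall v, v \in L <-> exists x, v = E *m x) ->
  HAW [set x | S (a0 + E *m x)] -> HAW_in a0 L (S `&` affine_subspace a0 L).
Proof.
move=> EE EL haw; exists (fun x => a0 + E *m x); split.
- move=> x y; rewrite opprD addrACA subrr add0r -mulmxBr.
  by rewrite /enorm dotv_mulmxl mulmxA EE mul1mx.
- apply/seteqP; split=> [_ [x _ <-]|_ [v /= /EL[x ->] <-]]; last by exists x.
  by exists (E *m x) => //=; apply/EL; exists x.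
- apply: HAW_sub haw => x Sx; split=> //.
  by exists (E *m x) => //=; apply/EL; exists x.
Qed.

(** Even here the balls must be shown to have a common point; playing for a
    smaller set provides one. *)
Lemma HAW_setT d : (0 < d)%N -> HAW [set: 'cV[R]_d].
Proof.
move=> d0.
pose w k : 'cV[R]_d := k.+1%:R *: const_mx 1.
have w_oo : enorm (w k) @[k --> \oo] --> +oo.
  have -> : (fun k => enorm (w k)) = fun k => k.+1%:R * enorm (const_mx 1 : 'cV[R]_d).
    by apply/funext => k; rewrite enormZ ger0_norm.
  by apply: cvgy_mulSn; rewrite enorm_gt0 const_neq0.
exact: HAW_sub (HAW_often_far d0 (fun=> 0) w_oo).
Qed.

Lemma HAW_in_often_far n (a0 : 'cV[R]_n) (L : {vspace 'cV[R]_n})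
    (E : 'M[R]_(n, \dim L)) (Y : nat -> 'cV[R]_n) (S : set 'cV[R]_n) :
  (0 < \dim L)%N ->
  E^T *m E = 1%:M -> (forall v, v \in L <-> exists x, v = E *m x) ->
  enorm (E^T *m Y k) @[k --> \oo] --> +oo ->
  (forall eta, often_far (fun k => dotv eta (Y k)) -> S eta) ->
  HAW_in a0 L (S `&` affine_subspace a0 L).
Proof.
move=> L0 EE EL Y_oo YS; apply: HAW_in_basis EE EL _.
apply: HAW_sub (HAW_often_far L0 (fun k => dotv a0 (Y k)) Y_oo) => x /= far.
apply: YS; congr often_far: far; apply/funext => k.
by rewrite dotvDl dotv_mulmxl addrC.
Qed.

(** Pairing [Y i] with the vector [E *m x] bounds the projection from below by
    the length of [Y i] times [dotv (unitv (Y i)) (E *m x)], and the second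
    factor has a nonzero limit. *)
Lemma enorm_proj_cvgy n k (E : 'M[R]_(n, k)) (Y : nat -> 'cV[R]_n) omega x :
  `|Y i| @[i --> \oo] --> +oo ->
  unitv (Y i) @[i --> \oo] --> omega -> dotv omega (E *m x) != 0 ->
  enorm (E^T *m Y i) @[i --> \oo] --> +oo.
Proof.
move=> Y_oo u_omega omega_x.
pose c := `|dotv omega (E *m x)| / 2 / (enorm x + 1).
have x1 : 0 < enorm x + 1 by rewrite ltr_wpDl ?enorm_ge0.
have c2 : 0 < `|dotv omega (E *m x)| / 2 by rewrite divr_gt0// normr_gt0.
have c0 : 0 < c by exact: divr_gt0.
have cY : `|Y i| * c @[i --> \oo] --> +oo.
  apply/cvgryPge => M; move/cvgryPge: Y_oo => /(_ (M / c)).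
  by apply: filterS => i; rewrite ler_pdivrMr.
apply: ger_cvgy cY.
have : dotv (unitv (Y i)) (E *m x) @[i --> \oo] --> dotv omega (E *m x).
  exact: cvg_comp u_omega (@dotv_continuous _ _ (E *m x) omega).
move=> /cvgrPdist_le/(_ _ c2); apply: filterS => i h.
have uc : `|dotv omega (E *m x)| / 2 <= `|dotv (unitv (Y i)) (E *m x)|.
  have := lerB_dist (dotv omega (E *m x)) (dotv (unitv (Y i)) (E *m x)).
  by move=> /le_trans/(_ h); lra.
rewrite /c mulrA ler_pdivrMr//.
have [Y0|Y0] := eqVneq (Y i) 0.
  by rewrite Y0 normr0 mul0r mulr_ge0 ?enorm_ge0// ltW.
apply: le_trans (_ : enorm (Y i) * `|dotv (unitv (Y i)) (E *m x)| <= _).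
  by rewrite ler_pM ?norm_le_enorm// ltW.
rewrite /unitv dotvZl normrM ger0_norm ?invr_ge0 ?enorm_ge0// mulrA.
rewrite mulfV ?enorm_eq0// mul1r dotv_mulmxr (le_trans (cauchy_schwarz _ _))//.
by rewrite ler_wpM2l ?enorm_ge0// lerDl.
Qed.

End HAW_affine.

(** * The two sources of approximating sequences *)

Section Cases.
Variable R : realType.

(** An integral relation and its multiples satisfy the approximation condition
    for every positive [f], the distance being 0. *)
Lemma integral_relation_multiples m n (Phi : 'M[R]_(m, n)) (z : 'cV[int]_n)
    (f : R -> R) :
  (0 < m)%N -> (0 < n)%N -> (forall t, 0 < t -> 0 < f t) ->
  integral_relation Phi z ->
  [/\ forall k, int_dist (Phi *m intv R (z *+ k.+1)) ^+ m <=
        f (`|intv R (z *+ k.+1)| ^+ n),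
      forall k, intv R (z *+ k.+1) = k.+1%:R *: intv R z
    & `|intv R (z *+ k.+1)| @[k --> \oo] --> +oo].
Proof.
move=> m0 n0 f_gt0 [z0 [p zp]].
have intvMn a (v : 'cV[int]_a) k : intv R (v *+ k.+1) = k.+1%:R *: intv R v.
  apply/matrixP => i j; rewrite !mxE mulmxnE rmorphMn/=.
  by rewrite mulr_natl.
have iz0 : 0 < `|intv R z|.
  rewrite normr_gt0; apply: contra z0 => /eqP/matrixP iz.
  apply/eqP/matrixP => i j; have := iz i j; rewrite !mxE => /eqP.
  by rewrite intr_eq0 => /eqP.
have norm_k k : `|intv R (z *+ k.+1)| = k.+1%:R * `|intv R z|.
  by rewrite intvMn normrZ ger0_norm.
split=> // [k|]; last by under eq_fun do rewrite norm_k; exact: cvgy_mulSn.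
apply: le_trans (_ : 0 ^+ m <= _).
  rewrite lerXn2r ?nnegrE ?int_dist_ge0//.
  apply: le_trans (int_dist_le _ (p *+ k.+1)) _.
  by rewrite !intvMn -scalemxAr zp subrr normr0.
by rewrite expr0n gtn_eqF//= ltW// f_gt0// exprn_gt0// norm_k mulr_gt0.
Qed.

(** By compactness of the unit sphere, the indices satisfying [P] contain a
    subsequence along which the directions converge; its limit is an asymptotic
    direction with all signs positive. *)
Lemma asymptotic_subsequence m n (Phi : 'M[R]_(m, n)) (y : nat -> 'cV[int]_n)
    (P : nat -> Prop) :
  ~ trivially_singular Phi -> best_approximations Phi y ->
  (forall N, exists2 nu, (N <= nu)%N & P nu) ->
  exists (h : nat -> nat) (omega : 'cV[R]_n),
    [/\ forall k, (h k < h k.+1)%N, forall k, P (h k),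
        asymptotic_directions Phi y omega
      & unitv (intv R (y (h k))) @[k --> \oo] --> omega].
Proof.
move=> nonsing best freq.
have [h0 h0_incr h0P] := frequently_subseq freq.
have y_neq0 nu : intv R (y nu) != 0.
  rewrite -normr_gt0; have [y0 y_incr _ _] := best.
  case: nu => [|nu]; first by rewrite y0.
  exact: le_lt_trans (y_incr nu).
have u_bounded k : `|unitv (intv R (y (h0 k)))| <= 1.
  by rewrite (le_trans (norm_le_enorm _))// enorm_unitv.
have [h1 h1_incr /cvg_ex[omega u_omega]] := bolzano_cV u_bounded.
have h_incr k : (h0 (h1 k) < h0 (h1 k.+1))%N by exact/increasing_homo.
exists (h0 \o h1), omega; split=> //; first by move=> k; exact: h0P.
split=> //; exists (h0 \o h1), (fun=> false); split=> //.
by under eq_fun do rewrite expr0 scale1r.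
Qed.

End Cases.

(** * Complements of singular sets are winning *)

Theorem theorem3p2 (R : realType) (m n : nat) (m_gt0 : (0 < m)%N)
    (n_gt0 : (0 < n)%N) (f finv : R -> R)
    (f_gt0 : forall t, 0 < t -> 0 < f t)
    (f_cont : forall t, 0 < t -> {for t, continuous f})
    (f_decr : forall s t, 0 < s -> s < t -> f t < f s)
    (f_inv : forall t, 0 < t -> finv (f t) = t)
    (f_lim : f t @[t --> +oo] --> (0 : R))
    (f_growth : exists2 gamma : R, 0 < gamma &
       \forall C \near +oo, forall T, 0 < T -> f (C * T) <= C `^ (- gamma) * f T)
    (Theta : 'M[R]_(n, m)) (f_approx : approximable Theta^T f)
    (y : nat -> 'cV[int]_n)
    (y_best : ~ trivially_singular Theta^T -> best_approximations Theta^T y) :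
  let g := fun T : R => 1 / finv (1 / T) in
  let Omega := asymptotic_directions Theta^T y in
  (forall (a0 : 'cV[R]_n) (L : {vspace 'cV[R]_n}),
     (0 < \dim L)%N ->
     (trivially_singular Theta^T ->
        ~ exceptional Theta^T (affine_subspace a0 L)) ->
     orthocompl L `&` Omega = set0 ->
     HAW_in a0 L (~` singular_hat Theta g `&` affine_subspace a0 L)) /\
  HAW (~` singular_hat Theta g).
Proof.
move=> g Omega; split=> [a0 L L0 not_exc L_Omega|].
  have [E [EE EL]] := orthonormal_basis L.
  have [sing|nonsing] := pselect (trivially_singular Theta^T).
    have [z rel_z] := sing.
    have [z_approx z_mul z_oo] := integral_relation_multiples m_gt0 n_gt0 f_gt0 rel_z.
    have far_S := often_far_not_singular m_gt0 n_gt0 f_gt0 f_cont f_decr f_inv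
      f_lim f_growth z_approx z_oo.
    (* The case distinction is whether [z] is orthogonal to [L]. *)
    have [Ez0|Ez0] := eqVneq (E^T *m intv R z) 0; last first.
      apply: HAW_in_often_far L0 EE EL _ far_S.
      under eq_fun do rewrite z_mul -scalemxAr enormZ ger0_norm//.
      by apply: cvgy_mulSn; rewrite enorm_gt0.
    have const_on_A x : dotv (a0 + E *m x) (intv R z) = dotv a0 (intv R z).
      by rewrite dotvDl dotv_mulmxl Ez0 dotv0r addr0.
    apply: (HAW_in_basis EE EL).
    apply: HAW_sub (HAW_setT L0) => x _; apply: far_S.
    under eq_fun do rewrite z_mul dotvZr const_on_A.
    apply: often_far_multiples => a az; apply: (not_exc sing).
    exists z, a; split=> // _ [v /= /EL[x' ->] <-].
    by rewrite /= const_on_A.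
  have best := y_best nonsing.
  have freq := best_approximations_approx f_decr f_approx best.
  have [h [omega [h_incr h_approx omega_Omega u_omega]]] :=
    asymptotic_subsequence nonsing best freq.
  have y_oo : `|intv R (y (h k))| @[k --> \oo] --> +oo.
    exact: cvg_comp (increasing_cvg h_incr) (best_approximations_cvgy best).
  have far_S := often_far_not_singular m_gt0 n_gt0 f_gt0 f_cont f_decr f_inv
      f_lim f_growth h_approx y_oo.
  have [x omega_x] : exists x, dotv omega (E *m x) != 0.
    apply: contrapT => no_x.
    suff : (orthocompl L `&` Omega) omega by rewrite L_Omega.
    split=> // v /EL[x ->]; apply/eqP/negPn/negP => vx.
    by apply: no_x; exists x.
  apply: HAW_in_often_far L0 EE EL _ far_S.
  exact: enorm_proj_cvgy y_oo u_omega omega_x.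
have [Y Y_approx Y_oo] := infinite_intv_cvg R f_approx.
have {}Y_approx k := (Y_approx k).2.
apply: (@HAW_sub _ _ [set x | often_far (fun k => dotv x (intv R (Y k)) + 0)]).
  move=> eta /= far.
  apply: often_far_not_singular Y_approx Y_oo _ => //.
  by congr often_far: far; apply/funext => k; rewrite addr0.
apply: HAW_often_far => //.
apply: ger_cvgy Y_oo; apply: nearW => k; exact: norm_le_enorm.
Qed.
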